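(* Let $k\in\{2,3,4\}$, and let $\beta>1$ if $k\in\{2,3\}$, $\beta\ge 2$ if $k=4$. Let $V,H,\mathcal{L},f$ be as in the context and assume $\|f(t)\|_\star^2\le C_f$ for all $t\le T$. Then the scheme $$\frac{A_k^\beta(\phi^{n+1})}{\Delta t}+\mathcal{L}B_k^\beta(\phi^{n+1})=f(t^{n+\beta})$$ is stable in the sense that $$g_k|\phi^{n+1}|^2+\frac12\Delta t\,\eta_k(\beta)\sum_{q=k}^{n+1}\|C_k^\beta(\phi^q)\|^2\le C\sum_{q=0}^{k-1}\big(|\phi^q|^2+\Delta t\|\phi^q\|^2\big)+\frac{T C_f}{2\eta_k(\beta)},\qquad \forall\, k\le n+1\le\frac{T}{\Delta t},$$ where $g_k$ is a positive constant depending only on $k$ and $C$ is a constant independent of $\Delta t$.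
   Context: Functional setting: $V\subset H=H'\subset V'$ are real Hilbert spaces with $V$ densely and continuously embedded in $H$, and $V'$ the dual of $V$. $(\cdot,\cdot)$ and $|\cdot|$ are the inner product and norm of $H$; $(\cdot,\cdot)$ also denotes the duality pairing between $V'$ and $V$. $\mathcal{L}:V\to V'$ is a positive definite, self-adjoint linear operator, and the norm of $V$ is $\|u\|=(\mathcal{L}u,u)^{1/2}$. The dual norm is $\|v\|_\star=\sup_{u\in V\setminus\{0\}}|(v,u)|/\|u\|$ for $v\in V'$. The source $f$ takes values in $V'$. The scheme approximates the linear problem $u_t+\mathcal{L}u=f$, $0<t<T$, with time step $\Delta t$; it determines $\phi^{n+1}$ for $n+1\ge k$ from starting values $\phi^0,\dots,\phi^{k-1}$. Notation: $t^{s}=s\Delta t$ for real $s$. $A_k^\beta(\phi^i)=\sum_{q=0}^{k}a_{k,q}\phi^{i-k+q}$, $B_k^\beta(\phi^i)=\sum_{q=0}^{k-1}b_{k,q}\phi^{i-k+1+q}$, $C_k^\beta(\phi^i)=\sum_{q=0}^{k-1}c_{k,q}\phi^{i-k+1+q}$, with coefficients depending on $\beta$ as follows. Also $\eta_2(\beta)=\frac{\beta-1}{\beta}$, $\eta_3(\beta)=\frac{\beta-1}{\beta+1}$, $\eta_4(\beta)=\frac{\beta-1}{\beta+3}$. $k=2$: $a_{2,2}=\frac{2\beta+1}{2}$, $a_{2,1}=-2\beta$, $a_{2,0}=\frac{2\beta-1}{2}$; $b_{2,1}=\beta$, $b_{2,0}=-(\beta-1)$; $c_{2,1}=\beta+1$,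 $c_{2,0}=-\beta$. $k=3$: $a_{3,3}=\frac{3\beta^2+6\beta+2}{6}$, $a_{3,2}=-\frac{9\beta^2+12\beta-3}{6}$, $a_{3,1}=\frac{9\beta^2+6\beta-6}{6}$, $a_{3,0}=-\frac{3\beta^2-1}{6}$; $b_{3,2}=\frac{\beta^2+\beta}{2}$, $b_{3,1}=-(\beta^2-1)$, $b_{3,0}=\frac{\beta^2-\beta}{2}$; $c_{3,2}=\frac{\beta^2+3\beta+2}{2}$, $c_{3,1}=-(\beta^2+2\beta)$, $c_{3,0}=\frac{\beta^2+\beta}{2}$. $k=4$: $a_{4,4}=\frac{2\beta^3+9\beta^2+11\beta+3}{12}$, $a_{4,3}=\frac{-8\beta^3-30\beta^2-20\beta+10}{12}$, $a_{4,2}=\frac{12\beta^3+36\beta^2+6\beta-18}{12}$, $a_{4,1}=\frac{-8\beta^3-18\beta^2+4\beta+6}{12}$, $a_{4,0}=\frac{2\beta^3+3\beta^2-\beta-1}{12}$; $b_{4,3}=\frac{\beta^3+3\beta^2+2\beta}{6}$, $b_{4,2}=\frac{-\beta^3-2\beta^2+\beta+2}{2}$, $b_{4,1}=\frac{\beta^3+\beta^2-2\beta}{2}$, $b_{4,0}=\frac{-\beta^3+\beta}{6}$; $c_{4,3}=\frac{\beta^3+6\beta^2+11\beta+6}{6}$, $c_{4,2}=\frac{-\beta^3-5\beta^2-6\beta}{2}$, $c_{4,1}=\frac{\beta^3+4\beta^2+3\beta}{2}$, $c_{4,0}=\frac{-\beta^3-3\beta^2-2\beta}{6}$.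
   Formalization: The constant g_k is allowed to depend on β as well as k (a value uniform in β is impossible), and the bound ‖f(t)‖_⋆² ≤ C_f is also assumed for T < t ≤ t^{n+β}, since the scheme evaluates f beyond T. *)

(* Defs.v *)
From HB Require Import structures.
From mathcomp Require Import all_boot all_order all_algebra sesquilinear.
From mathcomp Require Import all_classical all_reals all_analysis.

Set Implicit Arguments.
Unset Strict Implicit.
Unset Printing Implicit Defensive.

Import Order.TTheory GRing.Theory Num.Theory.
Import numFieldNormedType.Exports.

Local Open Scope classical_set_scope.
Local Open Scope ring_scope.

HB.mixin Record isHilbert (R : realType) U of CompleteNormedModule R U := {
  inner : {dot U for (idfun : R -> R)} ;
  norm_inner : forall u : U, `|u| = Num.sqrt (inner u u)
}.

#[short(type="hilbertType")]
HB.structure Definition Hilbert (R : realType) :=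
  { U of isHilbert R U & CompleteNormedModule R U }.

Section GelfandTriple.
Context {R : realType}.

(* V' is carved out of the R-module of all functions V -> R, so that equations
   in V' are equations between functions. *)
Definition cont_dual (V : normedModType R) : set (V -> R^o) :=
  [set l | linear l /\ continuous l].

Definition dual_norm (V : normedModType R) (l : V -> R^o) : R :=
  sup [set `|l u| / `|u| | u in [set u : V | u != 0]].

Definition dense_embedding (V H : normedModType R) (iota : V -> H) : Prop :=
  [/\ injective iota, continuous iota & dense (range iota)].

(* The inclusion of H = H' in V', along iota : V -> H. *)
Definition H_in_dual (V : normedModType R) (H : hilbertType R) (iota : V -> H)
  (h : H) : V -> R^o := fun v => inner h (iota v).

(* The pairing of V' and V is application, so (L u, v) is [L u v]. *)
Definition energy_operator (V : normedModType R) (L : V -> (V -> R^o)) : Prop :=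
  [/\ forall u, cont_dual (L u),
      forall u v, L u v = L v u,
      forall u, u != 0 -> 0 < L u u
    & forall u, `|u| = Num.sqrt (L u u)].

End GelfandTriple.
Arguments cont_dual {R} V _.

Section Scheme.
Context {R : realType}.
Implicit Types (k : nat) (b : R).

(* Coefficients are listed by increasing q. *)
Definition a_coef k b : seq R :=
  match k with
  | 2 => [:: (2 * b - 1) / 2;
             - (2 * b);
             (2 * b + 1) / 2]
  | 3 => [:: - ((3 * b ^+ 2 - 1) / 6);
             (9 * b ^+ 2 + 6 * b - 6) / 6;
             - ((9 * b ^+ 2 + 12 * b - 3) / 6);
             (3 * b ^+ 2 + 6 * b + 2) / 6]
  | 4 => [:: (2 * b ^+ 3 + 3 * b ^+ 2 - b - 1) / 12;
             (- 8 * b ^+ 3 - 18 * b ^+ 2 + 4 * b + 6) / 12;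
             (12 * b ^+ 3 + 36 * b ^+ 2 + 6 * b - 18) / 12;
             (- 8 * b ^+ 3 - 30 * b ^+ 2 - 20 * b + 10) / 12;
             (2 * b ^+ 3 + 9 * b ^+ 2 + 11 * b + 3) / 12]
  | _ => [::]
  end.

Definition b_coef k b : seq R :=
  match k with
  | 2 => [:: - (b - 1);
             b]
  | 3 => [:: (b ^+ 2 - b) / 2;
             - (b ^+ 2 - 1);
             (b ^+ 2 + b) / 2]
  | 4 => [:: (- b ^+ 3 + b) / 6;
             (b ^+ 3 + b ^+ 2 - 2 * b) / 2;
             (- b ^+ 3 - 2 * b ^+ 2 + b + 2) / 2;
             (b ^+ 3 + 3 * b ^+ 2 + 2 * b) / 6]
  | _ => [::]
  end.

Definition c_coef k b : seq R :=
  match k with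
  | 2 => [:: - b;
             b + 1]
  | 3 => [:: (b ^+ 2 + b) / 2;
             - (b ^+ 2 + 2 * b);
             (b ^+ 2 + 3 * b + 2) / 2]
  | 4 => [:: (- b ^+ 3 - 3 * b ^+ 2 - 2 * b) / 6;
             (b ^+ 3 + 4 * b ^+ 2 + 3 * b) / 2;
             (- b ^+ 3 - 5 * b ^+ 2 - 6 * b) / 2;
             (b ^+ 3 + 6 * b ^+ 2 + 11 * b + 6) / 6]
  | _ => [::]
  end.

Definition eta_coef k b : R :=
  match k with
  | 2 => (b - 1) / b
  | 3 => (b - 1) / (b + 1)
  | 4 => (b - 1) / (b + 3)
  | _ => 0
  end.

(* The natural subtraction i - k is truncated: these are the intended
   combinations of phi only for k <= i. *)
Definition A_op (V : lmodType R) k b (phi : nat -> V) (i : nat) : V :=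
  \sum_(q < k.+1) (a_coef k b)`_q *: phi (i - k + q)%N.

Definition B_op (V : lmodType R) k b (phi : nat -> V) (i : nat) : V :=
  \sum_(q < k) (b_coef k b)`_q *: phi (i - k + 1 + q)%N.

Definition C_op (V : lmodType R) k b (phi : nat -> V) (i : nat) : V :=
  \sum_(q < k) (c_coef k b)`_q *: phi (i - k + 1 + q)%N.

(* A_k(phi^{n+1}) / dt + L B_k(phi^{n+1}) = f(t^{n+b}), an equation in V'. *)
Definition scheme_step (V : normedModType R) (H : hilbertType R)
    (iota : V -> H) (L : V -> (V -> R^o)) (f : R -> (V -> R^o))
    k b (dt : R) (phi : nat -> V) (n : nat) : Prop :=
  dt^-1 *: H_in_dual iota (iota (A_op k b phi n.+1)) + L (B_op k b phi n.+1)
  = f ((n%:R + b) * dt).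

End Scheme.

(* Main.v *)
(* Apply the scheme at step [n] to [C_k(phi^{n+1})].  The products
   [(A_k(phi), C_k(phi))] in [H] and [(L (B_k(phi) - eta C_k(phi)), C_k(phi))]
   each dominate the increment, along the sequence, of a fixed positive definite
   quadratic form in the last iterates: this is G-stability in the sense of
   Dahlquist.  What is left is [dt eta |C_k(phi)|^2 <= dt (f, C_k(phi))] up to a
   telescoping sum, and Young's inequality splits the right-hand side.

   The forms come from a factorization on the unit circle.  The real part of
   [a(z) conj(z c(z))] is a polynomial in [x = cos t] with nonnegative
   coefficients on the products [(1 - x)^i (1 + x)^(k-i)]; as
   [1 -+ x = |1 -+ z|^2 / 2], it is a sum of squares
   [|(1 - z)^i (1 + z)^(k-i)|^2], and subtracting these squares from the
   product leaves a matrix that telescopes.  For the second product with k > 2 the symbol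
   has a negative coefficient, and squares of combinations are needed. *)

Require Import Defs.
From HB Require Import structures.
From mathcomp Require Import all_boot all_order all_algebra sesquilinear.
From mathcomp Require Import all_classical all_reals all_analysis.
From mathcomp Require Import ring lra.
Import Order.TTheory GRing.Theory Num.Theory.
Import numFieldNormedType.Exports.
Local Open Scope classical_set_scope.
Local Open Scope ring_scope.

(** * Semidefinite forms and quadratic forms in successive iterates *)

(** Covers both the [H] product pulled back to [V] and the energy form of [L], so that one kind of
    matrix certificate serves for either. *)
Record psd_form {R : realType} {V : lmodType R} (e : V -> V -> R) : Prop := {
  psd_sym : forall u v, e u v = e v u;
  psd_linl : forall (a : R) u v w, e (a *: u + v) w = a * e u w + e v w;
  psd_ge0 : forall u, 0 <= e u u }.
Arguments psd_sym {R V e} _.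
Arguments psd_linl {R V e} _.
Arguments psd_ge0 {R V e} _.

Definition quad {R : realType} {V : lmodType R} (e : V -> V -> R) (n : nat)
    (G : nat -> nat -> R) (x : nat -> V) : R :=
  \sum_(i < n) \sum_(j < n) G i j * e (x i) (x j).

(* Entry (i, j) of the symmetric matrix with the given upper triangle, listed
   by rows that start on the diagonal. *)
Fixpoint upper {R : realType} (g : seq (seq R)) (i j : nat) : R :=
  match g, i, j with
  | _ :: g', i'.+1, j'.+1 => upper g' i' j'
  | r :: _, 0%N, _ => r`_j
  | r :: _, _, 0%N => r`_i
  | [::], _, _ => 0
  end.

(** Bordering by zeros in front lets the form after a step be compared with the form before it in
    one common list of variables. *)
Definition shift_form {R : realType} (G : nat -> nat -> R) (i j : nat) : R :=
  match i, j with i'.+1, j'.+1 => G i' j' | _, _ => 0 end.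

(* Fraction-free pivots of the elimination of the variables in the order
   0, 1, 2: up to positive factors, the leading principal minors. *)
Fixpoint pivots {R : realType} (n : nat) (G : nat -> nat -> R) : Prop :=
  if n is n'.+1 then
    0 < G 0%N 0%N /\
    pivots n' (fun i j => G 0%N 0%N * G i.+1 j.+1 - G i.+1 0%N * G 0%N j.+1)
  else True.

(* [x n] is the newest iterate, so that [x] and [x \o S] list the arguments of the
   form before and after a step. *)
Definition dissipative {R : realType} (n : nat) (u v : seq R) : Prop :=
  exists (g : R) (G : nat -> nat -> R), 0 < g /\
  forall (V : lmodType R) (e : V -> V -> R) (x : nat -> V), psd_form e ->
    g * e (x n.-1) (x n.-1) <= quad e n G x /\
    quad e n G (x \o S) - quad e n G x
      <= e (\sum_(i < n.+1) u`_i *: x i) (\sum_(i < n.+1) v`_i *: x i).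

Section PsdForm.
Context {R : realType} {V : lmodType R} {e : V -> V -> R} (he : psd_form e).
Implicit Types (x : nat -> V) (u v w : V) (n : nat) (G : nat -> nat -> R).

Lemma psdDl u v w : e (u + v) w = e u w + e v w.
Proof. by have := psd_linl he 1 u v w; rewrite scale1r mul1r. Qed.

Lemma psd0l w : e 0 w = 0.
Proof. by apply: (@addrI _ (e 0 w)); rewrite -psdDl !addr0. Qed.

Lemma psdZl (a : R) u w : e (a *: u) w = a * e u w.
Proof. by rewrite -[a *: u]addr0 (psd_linl he) psd0l addr0. Qed.

Lemma psdDr u v w : e w (u + v) = e w u + e w v.
Proof. by rewrite !(psd_sym he w) psdDl. Qed.

Lemma psdZr (a : R) u w : e w (a *: u) = a * e w u.
Proof. by rewrite !(psd_sym he w) psdZl. Qed.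

Lemma psd_sum n (a b : nat -> R) x :
  e (\sum_(i < n) a i *: x i) (\sum_(i < n) b i *: x i)
  = quad e n (fun i j => a i * b j) x.
Proof.
have sl w (F : 'I_n -> V) : e (\sum_i F i) w = \sum_i e (F i) w.
  elim/big_rec2: _ => [|i r s _ <-]; [exact: psd0l | exact: psdDl].
rewrite /quad sl; apply: eq_bigr => i _; rewrite psdZl (psd_sym he) sl mulr_sumr.
by apply: eq_bigr => j _; rewrite psdZl (psd_sym he) mulrA.
Qed.

Lemma eq_quad n G G' x :
  (forall i j, (i < n)%N -> (j < n)%N -> G i j = G' i j) ->
  quad e n G x = quad e n G' x.
Proof.
by move=> h; apply: eq_bigr => i _; apply: eq_bigr => j _; rewrite h.
Qed.

Lemma quadD n G G' x :
  quad e n (fun i j => G i j + G' i j) x = quad e n G x + quad e n G' x.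
Proof.
rewrite -big_split; apply: eq_bigr => i _; rewrite -big_split.
by apply: eq_bigr => j _; rewrite mulrDl.
Qed.

Lemma quadZ n (a : R) G x :
  quad e n (fun i j => a * G i j) x = a * quad e n G x.
Proof.
rewrite mulr_sumr; apply: eq_bigr => i _; rewrite mulr_sumr.
by apply: eq_bigr => j _; rewrite mulrA.
Qed.

Lemma quad_tr n G x : quad e n (fun i j => G j i) x = quad e n G x.
Proof.
rewrite /quad exchange_big; apply: eq_bigr => i _; apply: eq_bigr => j _.
by rewrite (psd_sym he).
Qed.

Lemma quad_recl n G x :
  quad e n.+1 G x = G 0%N 0%N * e (x 0%N) (x 0%N)
    + (\sum_(j < n) G 0%N j.+1 * e (x 0%N) (x j.+1)
       + \sum_(i < n) G i.+1 0%N * e (x i.+1) (x 0%N))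
    + quad e n (fun i j => G i.+1 j.+1) (x \o S).
Proof.
rewrite /quad big_ord_recl big_ord_recl /= -!addrA; congr (_ + (_ + _)).
by rewrite -big_split; apply: eq_bigr => i _; rewrite big_ord_recl.
Qed.

Lemma quad_shift n G x :
  quad e n.+1 (shift_form G) x = quad e n G (x \o S).
Proof.
by rewrite quad_recl mul0r !big1 ?addr0 ?add0r // => i _; rewrite mul0r.
Qed.

Lemma quad_widen n G x : (forall i, (i <= n)%N -> G i n = 0 /\ G n i = 0) ->
  quad e n.+1 G x = quad e n G x.
Proof.
move=> G0; rewrite /quad big_ord_recr /= [X in _ + X]big1 ?addr0.
  by apply: eq_bigr => i _; rewrite big_ord_recr /= (G0 i _).1 ?mul0r ?addr0 // ltnW.
by move=> j _; rewrite (G0 j _).2 ?mul0r // -ltnS.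
Qed.

Lemma quad_squares n (sq : seq (R * seq R)) x :
  quad e n (fun i j => \sum_(s <- sq) s.1 * (s.2`_i * s.2`_j)) x
  = \sum_(s <- sq) s.1 * e (\sum_(i < n) s.2`_i *: x i) (\sum_(i < n) s.2`_i *: x i).
Proof.
elim: sq => [|s sq IH].
  by rewrite big_nil /quad big1 // => i _; rewrite big1 // => j _; rewrite big_nil mul0r.
rewrite big_cons -IH psd_sum -quadZ -quadD; apply: eq_quad => i j _ _.
by rewrite big_cons.
Qed.

(** Positivity at [x i + x j] and [x i - x j] bounds [e (x i) (x j)] in absolute value by the mean
    of two diagonal terms, each at most the whole sum. *)
Lemma quad_le n G x :
  quad e n G x <=
  (\sum_(i < n) \sum_(j < n) `|G i j|) * \sum_(i < n) e (x i) (x i).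
Proof.
rewrite /quad mulr_suml; apply: ler_sum => i _.
rewrite mulr_suml; apply: ler_sum => j _.
apply: (le_trans (ler_norm _)); rewrite normrM ler_wpM2l //.
have le_sum (k : 'I_n) : e (x k) (x k) <= \sum_(i < n) e (x i) (x i).
  by rewrite (bigD1 k) //= lerDl sumr_ge0 // => l _; exact: psd_ge0.
have pD := psd_ge0 he (x i + x j); have pB := psd_ge0 he (x i + -1 *: x j).
move: pD pB; rewrite !(psdDl, psdDr, psdZl, psdZr) (psd_sym he (x j)).
have := le_sum i; have := le_sum j; rewrite ler_norml => *.
by apply/andP; split; lra.
Qed.

End PsdForm.

(* Completing the square in the variable of index 0 divides the form by G 0 0
   and leaves the condensed form in the other variables. *)
Lemma pivots_lower {R : realType} {n : nat} {G : nat -> nat -> R} :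
  (forall i j, G i j = G j i) -> pivots n.+1 G ->
  exists2 g : R, 0 < g &
    forall (V : lmodType R) (e : V -> V -> R) (x : nat -> V), psd_form e ->
    g * e (x n) (x n) <= quad e n.+1 G x.
Proof.
elim: n G => [|n IH] G Gsym.
  by case=> G0 _; exists (G 0%N 0%N) => // V e x _; rewrite /quad !big_ord1.
rewrite [pivots _ _]/=; case=> G0 pG.
set G' := fun i j => G 0%N 0%N * G i.+1 j.+1 - G i.+1 0%N * G 0%N j.+1.
have G'sym i j : G' i j = G' j i.
  by rewrite /G' (Gsym i.+1 j.+1) (Gsym 0%N j.+1) (Gsym i.+1 0%N) [G 0%N i.+1 * _]mulrC.
have [g g0 gP] := IH _ G'sym pG.
exists (g / G 0%N 0%N); first exact: divr_gt0.
move=> V e x he; rewrite mulrAC ler_pdivrMr //.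
apply: (le_trans (gP _ _ (x \o S) he)).
pose l := \sum_(i < n.+2) G 0%N i *: x i.
suff <- : e l l + quad e n.+1 G' (x \o S) = quad e n.+2 G x * G 0%N 0%N.
  by rewrite lerDr (psd_ge0 he).
(* [M] is [G'] bordered by a zero row and column at index 0. *)
pose M i j := G 0%N 0%N * G i j - G i 0%N * G 0%N j.
have -> : quad e n.+1 G' (x \o S) = quad e n.+2 M x.
  rewrite (quad_recl _ M) /M subrr mul0r !big1 ?addr0 ?add0r // => i _ /=;
    by rewrite [G 0%N 0%N * _]mulrC subrr mul0r.
rewrite /l (psd_sum he) -quadD mulrC -quadZ; apply: eq_quad => i j _ _.
by rewrite /M (Gsym i 0%N) addrC subrK.
Qed.

(** * Certificates of dissipativity by explicit matrices and squares *)

Lemma upperC {R : realType} (g : seq (seq R)) i j : upper g i j = upper g j i.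
Proof. by elim: g i j => [|r g IH] [|i] [|j] //=. Qed.

(* The last hypothesis is the identity
   [d e(u, v) = quad g (x \o S) - quad g x + sum of weighted squares],
   coefficient by coefficient and symmetrized, whence the factor 2. *)
Lemma dissipative_certificate {R : realType} (n : nat) (d : R) (u v : seq R)
    (g : seq (seq R)) (sq : seq (R * seq R)) :
  0 < d -> pivots n.+1 (upper g) ->
  (forall i, (i <= n.+1)%N -> upper g i n.+1 = 0) ->
  all (fun s => 0 <= s.1) sq ->
  (forall i j, (i <= n.+1)%N -> (j <= n.+1)%N ->
     d * (u`_i * v`_j + u`_j * v`_i)
     = 2 * (shift_form (upper g) i j
            - upper g i j + \sum_(s <- sq) s.1 * (s.2`_i * s.2`_j))) ->
  dissipative n.+1 u v.
Proof.
move=> d0 gP g0 sqP uvE.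
have [c c0 cP] := pivots_lower (upperC g) gP.
exists (c / d), (fun i j => d^-1 * upper g i j); split; first exact: divr_gt0.
move=> V e x he; rewrite !quadZ; split.
  by rewrite mulrAC mulrC ler_pM2l ?invr_gt0 //; exact: cP.
rewrite -mulrBr mulrC ler_pdivrMr // psd_sum // -quad_shift //.
rewrite -[quad e n.+1 (upper g) x]quad_widen; last first.
  by move=> i ile; rewrite (upperC g n.+1); split; exact: g0.
rewrite -subr_ge0 -(@pmulr_lge0 _ 2) //.
set N := quad e n.+2 (fun i j => u`_i * v`_j) x.
set G' := quad _ _ _ x; set G'' := quad _ _ _ x.
suff -> : (N * d - (G' - G'')) * 2
    = 2 * quad e n.+2 (fun i j => \sum_(s <- sq) s.1 * (s.2`_i * s.2`_j)) x.
  rewrite mulr_ge0 // (quad_squares he) big_seq sumr_ge0 // => s ssq.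
  by rewrite mulr_ge0 ?psd_ge0 ?(allP sqP).
have -> : (N * d - (G' - G'')) * 2 = d * (N + N) + -2 * (G' + -1 * G'') by ring.
(* Replacing one copy of [N] by its transpose symmetrizes the matrix, so that entries can be
   compared one by one. *)
rewrite -[X in d * (_ + X)](quad_tr he) -quadD -!quadZ -quadD -!quadZ -quadD.
apply: eq_quad => i j ile jle; rewrite uvE //; ring.
Qed.

(** What is left of [B_k] once the share [eta C_k], the source of the coercive term, is set
    aside. *)
Definition excess {R : realType} (k : nat) (b : R) : seq R :=
  mkseq (fun q => (b_coef k b)`_q - eta_coef k b * (c_coef k b)`_q) k.

Lemma shift_base {R : realType} (a b : R) : a <= b -> exists2 s : R, 0 <= s & b = a + s.
Proof. by move=> ab; exists (b - a); [rewrite subr_ge0 | rewrite addrC subrK]. Qed.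

Ltac check_entries :=
  move=> [|[|[|[|[|i]]]]] [|[|[|[|[|j]]]]] => //;
  rewrite ?big_cons big_nil => _ _;
  cbn [shift_form upper nth a_coef b_coef c_coef eta_coef excess mkseq map iota fst snd].

Ltac powers s n :=
  match n with
  | 1%nat => idtac
  | S ?n' => have ? : 0 <= s ^+ n by [exact: exprn_ge0]; powers s n'
  end.

(* All the polynomials met here have nonnegative coefficients in [s]; once the
   powers of [s] are known to be nonnegative, positivity is a linear problem. *)
Ltac check_pivots s n :=
  powers s n; cbn [pivots upper nth]; repeat (split; [lra|]); exact I.

Ltac check_weights s n :=
  powers s n; cbn [all fst]; repeat (apply/andP; split; [lra|]); exact isT.

(** * Certificates for [k = 2, 3, 4] *)

(** The leading zero aligns [C_k], which starts one iterate later, with [A_k]. The entries of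
    [a_coef] sum to zero, so the symbol vanishes at [z = 1] and every square has a factor [1 - z];
    the same holds for [k = 3, 4]. *)
Lemma dissipative_A2 {R : realType} (b : R) : 1 <= b ->
  dissipative 2 (a_coef 2 b) (0 :: c_coef 2 b).
Proof.
move=> b1; apply: (dissipative_certificate 1 4 _ _
  [:: [:: 2 * b ^+ 2 + b + 1; - 2 * b ^+ 2 - 3 * b];
      [:: 2 * b ^+ 2 + 5 * b + 1]]
  [:: (1, [:: 1; 0; -1]); (2 * b ^+ 2 + b, [:: 1; -2; 1])]) => [||||].
- by [].
- by have [s s0 ->] := shift_base _ _ b1; check_pivots s 4%N.
- by move=> [|[|[|i]]].
- by have [s s0 ->] := shift_base _ _ b1; check_weights s 2%N.
- by check_entries; lra.
Qed.

Lemma dissipative_A3 {R : realType} (b : R) : 1 <= b ->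
  dissipative 3 (a_coef 3 b) (0 :: c_coef 3 b).
Proof.
move=> b1; apply: (dissipative_certificate 2 24 _ _
  [:: [:: 3 * b ^+ 4 + 9 * b ^+ 3 + 8 * b ^+ 2 + 2 * b + 4;
          - 6 * b ^+ 4 - 24 * b ^+ 3 - 22 * b ^+ 2 - 2 * b;
          3 * b ^+ 4 + 15 * b ^+ 3 + 20 * b ^+ 2 - 6];
      [:: 12 * b ^+ 4 + 60 * b ^+ 3 + 68 * b ^+ 2 + 12 * b + 4;
          - 6 * b ^+ 4 - 36 * b ^+ 3 - 58 * b ^+ 2 - 22 * b + 6];
      [:: 3 * b ^+ 4 + 21 * b ^+ 3 + 44 * b ^+ 2 + 34 * b + 4]]
  [:: (3 / 2, [:: 1; 1; -1; -1]);
      ((3 * b ^+ 2 + 5 * b + 6) / 2, [:: 1; -1; -1; 1]);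
      ((6 * b ^+ 4 + 18 * b ^+ 3 + 13 * b ^+ 2 - b - 1) / 2,
       [:: 1; -3; 3; -1])]) => [||||].
- by [].
- by have [s s0 ->] := shift_base _ _ b1; check_pivots s 16%N.
- by move=> [|[|[|[|i]]]].
- by have [s s0 ->] := shift_base _ _ b1; check_weights s 4%N.
- by check_entries; lra.
Qed.

Lemma dissipative_A4 {R : realType} (b : R) : 2 <= b ->
  dissipative 4 (a_coef 4 b) (0 :: c_coef 4 b).
Proof.
move=> b2; apply: (dissipative_certificate 3 144 _ _
  [:: [:: 2 * b ^+ 6 + 15 * b ^+ 5 + 39 * b ^+ 4 + 39 * b ^+ 3 + 10 * b ^+ 2
            + 15;
          3 * (- 2 * b ^+ 6 - 17 * b ^+ 5 - 48 * b ^+ 4 - 51 * b ^+ 3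
            - 12 * b ^+ 2 + 5 * b - 2);
          3 * (2 * b ^+ 6 + 19 * b ^+ 5 + 61 * b ^+ 4 + 73 * b ^+ 3
            + 18 * b ^+ 2 - 14 * b - 7);
          - 2 * b ^+ 6 - 21 * b ^+ 5 - 78 * b ^+ 4 - 117 * b ^+ 3
            - 46 * b ^+ 2 + 33 * b + 18];
      [:: 3 * (6 * b ^+ 6 + 57 * b ^+ 5 + 177 * b ^+ 4 + 207 * b ^+ 3
            + 56 * b ^+ 2 - 26 * b + 11);
          3 * (- 6 * b ^+ 6 - 63 * b ^+ 5 - 222 * b ^+ 4 - 303 * b ^+ 3
            - 106 * b ^+ 2 + 43 * b + 10);
          3 * (2 * b ^+ 6 + 23 * b ^+ 5 + 93 * b ^+ 4 + 159 * b ^+ 3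
            + 92 * b ^+ 2 - 28 * b - 29)];
      [:: 3 * (6 * b ^+ 6 + 69 * b ^+ 5 + 273 * b ^+ 4 + 441 * b ^+ 3
            + 230 * b ^+ 2 - 20 * b + 1);
          3 * (- 2 * b ^+ 6 - 25 * b ^+ 5 - 112 * b ^+ 4 - 223 * b ^+ 3
            - 184 * b ^+ 2 - 27 * b + 22)];
      [:: 2 * b ^+ 6 + 27 * b ^+ 5 + 135 * b ^+ 4 + 321 * b ^+ 3
            + 376 * b ^+ 2 + 198 * b + 21]]
  [:: (9 / 4, [:: 1; 2; 0; -2; -1]);
      (6, [:: 1; 0; -2; 0; 1]);
      ((2 * b ^+ 3 + 18 * b ^+ 2 + 34 * b + 33) / 4, [:: 1; -2; 0; 2; -1]);
      ((4 * b ^+ 6 + 30 * b ^+ 5 + 78 * b ^+ 4 + 77 * b ^+ 3 + 11 * b ^+ 2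
          - 17 * b - 3) / 2, [:: 1; -4; 6; -4; 1])]) => [||||].
- by [].
- by have [s s0 ->] := shift_base _ _ b2; check_pivots s 48%N.
- by move=> [|[|[|[|[|i]]]]].
- by have [s s0 ->] := shift_base _ _ b2; check_weights s 6%N.
- by check_entries; lra.
Qed.

Lemma dissipative_D2 {R : realType} (b : R) : 1 <= b ->
  dissipative 1 (excess 2 b) (c_coef 2 b).
Proof.
move=> b1; apply: (dissipative_certificate 0 (2 * b) _ _
  [:: [:: b + 1]]
  [:: (1 / 2, [:: 1; 1]); ((2 * b + 1) / 2, [:: 1; -1])]) => [||||].
- lra.
- by have [s s0 ->] := shift_base _ _ b1; check_pivots s 2%N.
- by move=> [|[|i]].
- by have [s s0 ->] := shift_base _ _ b1; check_weights s 2%N.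
- by check_entries; field; lra.
Qed.

(** With [q = 1 + x] and [p = 1 - x], the scaled symbol has mixed term [- 2 (b - 1) q p]. The first
    square, equal to [(2 q - (b - 1) p)^2] on the circle, absorbs it and leaves a multiple of
    [p^2]. *)
Lemma dissipative_D3 {R : realType} (b : R) : 1 <= b ->
  dissipative 2 (excess 3 b) (c_coef 3 b).
Proof.
move=> b1; apply: (dissipative_certificate 1 (4 * (b + 1)) _ _
  [:: [:: b ^+ 3 + 2 * b ^+ 2 + b; - b ^+ 3 - 4 * b ^+ 2 - 2 * b + 1];
      [:: b ^+ 3 + 6 * b ^+ 2 + 9 * b + 4]]
  [:: (1 / 2, [:: (b + 1) / 2; 3 - b; (b + 1) / 2]);
      ((8 * b ^+ 3 + 15 * b ^+ 2 + 6 * b - 1) / 8, [:: 1; -2; 1])]) => [||||].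
- lra.
- by have [s s0 ->] := shift_base _ _ b1; check_pivots s 6%N.
- by move=> [|[|[|i]]].
- by have [s s0 ->] := shift_base _ _ b1; check_weights s 3%N.
- by check_entries; field; lra.
Qed.

Lemma dissipative_D4 {R : realType} (b : R) : 2 <= b ->
  dissipative 3 (excess 4 b) (c_coef 4 b).
Proof.
move=> b2.
(* On the circle, up to the factor [b + 3], the symbol is a cubic
   [q^3 / 2 - ...] in [q = 1 + x] and [p = 1 - x]; it is split as
   [q (q - (b + b^2) p)^2 / 2 + p r(q, p)], and the quadratic [r] as three
   squares by way of [k] and [l]. *)
pose k := (80 * b ^+ 2 + 228 * b + 229) / 192; pose l := 91 * b / 192.
apply: (dissipative_certificate 2 (24 * (b + 3)) _ _
  [:: [:: 3 * b ^+ 5 + 16 * b ^+ 4 + 25 * b ^+ 3 + 20 * b ^+ 2 + 8 * b + 3;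
          - 6 * b ^+ 5 - 35 * b ^+ 4 - 54 * b ^+ 3 - 13 * b ^+ 2 + 12 * b + 9;
          3 * b ^+ 5 + 19 * b ^+ 4 + 39 * b ^+ 3 + 29 * b ^+ 2 + 6 * b];
      [:: 12 * b ^+ 5 + 76 * b ^+ 4 + 136 * b ^+ 3 + 20 * b ^+ 2 - 64 * b + 12;
          - 6 * b ^+ 5 - 41 * b ^+ 4 - 102 * b ^+ 3 - 91 * b ^+ 2 + 12 * b
            + 27];
      [:: 3 * b ^+ 5 + 22 * b ^+ 4 + 73 * b ^+ 3 + 110 * b ^+ 2 + 80 * b + 21]]
  [:: (3 / 2, [:: 1 + b + b ^+ 2; 3 - b - b ^+ 2; 3 - b - b ^+ 2;
                  1 + b + b ^+ 2]);
      (* These are the coefficients of [(1 - z) ((1 + z)^2 + k (1 - z)^2)], whose squared modulus is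
         a multiple of [p (q - k p)^2]; likewise with [l] below. *)
      (3 * b * (4 * b + 3) / 4,
       [:: 1 + k; 1 - 3 * k; 3 * k - 1; - 1 - k]);
      (9 / 4, [:: 1 + l; 1 - 3 * l; 3 * l - 1; - 1 - l]);
      ((8 * b ^+ 6 + 60 * b ^+ 5 + 152 * b ^+ 4 + 132 * b ^+ 3 - 16 * b ^+ 2
          - 57 * b - 9) / 12
         - 3 * b * (4 * b + 3) / 4 * k ^+ 2 - 9 / 4 * l ^+ 2,
       [:: 1; -3; 3; -1])]) => [||||].
- lra.
- by have [s s0 ->] := shift_base _ _ b2; check_pivots s 20%N.
- by move=> [|[|[|[|i]]]].
- by rewrite /k /l; have [s s0 ->] := shift_base _ _ b2; check_weights s 6%N.
- check_entries; rewrite /k /l; field; lra.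
Qed.

Lemma dissipative_scheme {R : realType} (k : nat) (beta : R) :
  ((k = 2%N \/ k = 3%N) /\ 1 < beta) \/ (k = 4%N /\ 2 <= beta) ->
  [/\ 0 < eta_coef k beta, dissipative k (a_coef k beta) (0 :: c_coef k beta)
    & dissipative k.-1 (excess k beta) (c_coef k beta)].
Proof.
move=> [[[->|->] b1]|[-> b2]].
- split; [by rewrite /= divr_gt0; lra
         | exact: dissipative_A2 _ (ltW b1) | exact: dissipative_D2 _ (ltW b1)].
- split; [by rewrite /= divr_gt0; lra
         | exact: dissipative_A3 _ (ltW b1) | exact: dissipative_D3 _ (ltW b1)].
- split; [by rewrite /= divr_gt0; lra
         | exact: dissipative_A4 _ b2 | exact: dissipative_D4 _ b2].
Qed.

(** * The dual norm and the two forms on [V] *)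

(** Continuity bounds the set of quotients, so that its [sup] is a true supremum and not a default
    value. *)
Lemma le_dual_norm {R : realType} {V : normedModType R} {l : V -> R^o} (u : V) :
  cont_dual V l -> l u <= dual_norm l * `|u|.
Proof.
case=> l_lin l_cont.
pose lM := GRing.isLinear.Build R V R^o *:%R l l_lin.
pose lL : {linear V -> R^o} := HB.pack l lM.
have /linear_bounded_continuous/linear_boundedP lB : continuous lL := l_cont.
have [M [M0 lM']] := pinfty_ex_gt0 lB.
have l0 : l 0 = 0 := linear0 lL.
have [->|u0] := eqVneq u 0; first by rewrite l0 normr0 mulr0.
apply: (le_trans (ler_norm _)); rewrite -ler_pdivrMr ?normr_gt0 //.
apply: ub_le_sup; last by exists u.
by exists M => _ [v v0 <-]; rewrite ler_pdivrMr ?normr_gt0 //; exact: lM'.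
Qed.

Lemma psd_form_inner {R : realType} {V H : hilbertType R} (iota : {linear V -> H}) :
  psd_form (fun u v : V => inner (iota u) (iota v)).
Proof.
split=> [u v|a u v w|u].
- by rewrite hermC expr0 mul1r.
- by rewrite linearP linearPl.
- have [->|u0] := eqVneq (iota u) 0; first by rewrite linear0l.
  exact: ltW (neq0_dnorm_gt0 _ u0).
Qed.

Lemma psd_form_energy {R : realType} {V : hilbertType R}
    (L : {linear V -> (V -> R^o)}) : energy_operator L ->
  psd_form (fun u v : V => L u v : R).
Proof.
case=> Lc Ls Lp _; split=> [u v|a u v w|u]; first exact: Ls.
- by rewrite linearP.
- have [->|u0] := eqVneq u 0; first by rewrite linear0.
  exact: ltW (Lp _ u0).
Qed.

Lemma sqr_norm_inner {R : realType} {H : hilbertType R} (u : H) :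
  inner u u = `|u| ^+ 2.
Proof.
rewrite norm_inner sqr_sqrtr //.
have [->|u0] := eqVneq u 0; first by rewrite linear0l.
exact: ltW (neq0_dnorm_gt0 _ u0).
Qed.

(** * The discrete energy estimate *)

(** Both forms end at iterate [p + k - 1]; the second starts one later because [B_k] and [C_k]
    involve one iterate fewer than [A_k]. *)
Definition energy {R : realType} {V : lmodType R} (k : nat) (eH eV : V -> V -> R)
    (G G' : nat -> nat -> R) (dt : R) (phi : nat -> V) (p : nat) : R :=
  quad eH k G (fun q => phi (p + q)%N)
  + dt * quad eV k.-1 G' (fun q => phi (p.+1 + q)%N).

(** At [p = 0] only starting values enter, and the absolute entries of both matrices give a [C]
    chosen before [dt]. *)
Lemma energy0_le {R : realType} {V : lmodType R} (k : nat) (eH eV : V -> V -> R)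
    (G G' : nat -> nat -> R) : psd_form eH -> psd_form eV ->
  exists C : R, forall (dt : R) (phi : nat -> V), 0 < dt ->
    energy k eH eV G G' dt phi 0
    <= C * \sum_(0 <= q < k) (eH (phi q) (phi q) + dt * eV (phi q) (phi q)).
Proof.
move=> hH hV.
pose M n (K : nat -> nat -> R) := \sum_(i < n) \sum_(j < n) `|K i j|.
have M0 n K : 0 <= M n K by apply: sumr_ge0 => i _; exact: sumr_ge0.
exists (M k G + M k.-1 G') => dt phi dt0; rewrite /energy.
rewrite big_split -mulr_sumr /=.
have sH : 0 <= \sum_(0 <= q < k) eH (phi q) (phi q).
  by apply: sumr_ge0 => q _; exact: psd_ge0.
have sV : 0 <= \sum_(0 <= q < k) eV (phi q) (phi q).
  by apply: sumr_ge0 => q _; exact: psd_ge0.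
have qH := quad_le hH k G (fun q => phi (0 + q)%N).
have qV := quad_le hV k.-1 G' (fun q => phi (1 + q)%N).
have {}qV : quad eV k.-1 G' (fun q => phi (1 + q)%N)
    <= M k.-1 G' * \sum_(0 <= q < k) eV (phi q) (phi q).
  apply: (le_trans qV); apply: ler_wpM2l; [exact: M0 | rewrite big_mkord].
  case: k {qH sH sV qV} => [|k]; first by rewrite !big_ord0.
  by rewrite big_ord_recl lerDr psd_ge0.
rewrite -(big_mkord xpredT (fun q => eH (phi q) (phi q))) in qH.
rewrite mulrDl !mulrDr.
have := ler_wpM2l (ltW dt0) qV.
have := mulr_ge0 (M0 k G) (mulr_ge0 (ltW dt0) sV).
have := mulr_ge0 (M0 k.-1 G') sH.
move: qH; rewrite /M => *; nra.
Qed.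

(** The [H] inequality plus [dt] times the [V] one bounds the increment by
    [dt ((f, c) - eta |c|^2)]. Young's inequality spends half of [eta |c|^2], whence the factor
    1/2. *)
Lemma energy_step {R : realType} {V H : hilbertType R} (iota : {linear V -> H})
    (L : {linear V -> (V -> R^o)}) (f : R -> (V -> R^o)) (k : nat)
    (b dt Cf : R) (G G' : nat -> nat -> R) (phi : nat -> V) (p n : nat) :
  let eH := fun u v : V => inner (iota u) (iota v) in
  let eV := fun u v : V => L u v : R in
  let eta := eta_coef k b in
  energy_operator L -> (forall t, cont_dual V (f t)) -> 0 < dt -> 0 < eta ->
  (0 < k)%N ->
  (forall x, quad eH k G (x \o S) - quad eH k G x
     <= eH (\sum_(i < k.+1) (a_coef k b)`_i *: x i)
           (\sum_(i < k.+1) (0 :: c_coef k b)`_i *: x i)) ->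
  (forall x, quad eV k.-1 G' (x \o S) - quad eV k.-1 G' x
     <= eV (\sum_(i < k) (excess k b)`_i *: x i)
           (\sum_(i < k) (c_coef k b)`_i *: x i)) ->
  (p + k)%N = n.+1 -> scheme_step iota L f k b dt phi n ->
  dual_norm (f ((n%:R + b) * dt)) ^+ 2 <= Cf ->
  energy k eH eV G G' dt phi p.+1 + 2^-1 * dt * eta * `|C_op k b phi n.+1| ^+ 2
  <= energy k eH eV G G' dt phi p + dt * (Cf / (2 * eta)).
Proof.
move=> eH eV eta Le fc dt0 eta0 k0 GA GD pn hs fCf.
have hH : psd_form eH := psd_form_inner iota.
have hV : psd_form eV := psd_form_energy L Le.
set c := C_op k b phi n.+1; set a := A_op k b phi n.+1.
have AE : \sum_(i < k.+1) (a_coef k b)`_i *: phi (p + i)%N = a.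
  by rewrite /a -pn /A_op addnK.
have CE : \sum_(i < k) (c_coef k b)`_i *: phi (p.+1 + i)%N = c.
  by rewrite /c -pn /C_op addnK addn1.
have CE' : \sum_(i < k.+1) (0 :: c_coef k b)`_i *: phi (p + i)%N = c.
  rewrite big_ord_recl scale0r add0r -CE; apply: eq_bigr => i _ /=.
  by rewrite /bump /= addnA addn1.
have BE : \sum_(i < k) (excess k b)`_i *: phi (p.+1 + i)%N
    = B_op k b phi n.+1 + - eta *: c.
  rewrite -CE /B_op -pn addnK addn1 scaler_sumr -big_split; apply: eq_bigr => i _.
  by rewrite /excess nth_mkseq //= scalerA -scalerDl mulNr.
have := GA (fun q => phi (p + q)%N); have := GD (fun q => phi (p.+1 + q)%N).
rewrite AE CE CE' BE (psdDl hV) (psdZl hV) => {}GD {}GA.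
have hc : dt^-1 * eH a c + eV (B_op k b phi n.+1) c = f ((n%:R + b) * dt) c.
  by have <- := congr1 (fun l : V -> R^o => l c) hs; reflexivity.
have nc : `|c| ^+ 2 = eV c c.
  by have [_ _ _ ->] := Le; rewrite sqr_sqrtr // (psd_ge0 hV).
have fle := le_dual_norm c (fc ((n%:R + b) * dt)).
have shE (q : nat) : (fun i => phi (q + i)%N) \o S = (fun i => phi (q.+1 + i)%N).
  by apply/funext => i /=; rewrite addnS.
rewrite !shE in GA GD.
rewrite /energy nc.
set F := dual_norm _ in fCf fle.
(* Young: [F |c| <= eta / 2 |c|^2 + F^2 / (2 eta)] *)
have young : F * `|c| <= eta / 2 * eV c c + Cf / (2 * eta).
  rewrite -nc; have -> : Cf / (2 * eta) = (Cf - F ^+ 2) / (2 * eta) + F ^+ 2 / (2 * eta).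
    by field; lra.
  have : 0 <= (Cf - F ^+ 2) / (2 * eta) by rewrite divr_ge0 ?subr_ge0 // mulr_ge0 // ltW.
  have : 0 <= (eta * `|c| - F) ^+ 2 / (2 * eta).
    by rewrite divr_ge0 ?sqr_ge0 // mulr_ge0 // ltW.
  have -> : (eta * `|c| - F) ^+ 2 / (2 * eta)
    = eta / 2 * `|c| ^+ 2 + F ^+ 2 / (2 * eta) - F * `|c| by field; lra.
  by move=> *; lra.
have {}hc : eH a c + dt * eV (B_op k b phi n.+1) c = dt * f ((n%:R + b) * dt) c.
  by rewrite -hc mulrDr mulVKf // lt0r_neq0.
have := ler_wpM2l (ltW dt0) (le_trans fle young).
have := ler_wpM2l (ltW dt0) GD.
rewrite -/eta; move: hc GA; rewrite /eV /= => *; lra.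
Qed.

Theorem theorem2 (R : realType) (k : nat) (beta : R) :
  ((k = 2%N \/ k = 3%N) /\ 1 < beta) \/ (k = 4%N /\ 2 <= beta) ->
  exists2 g : R, 0 < g &
  forall (V H : hilbertType R) (iota : {linear V -> H})
         (L : {linear V -> (V -> R^o)}) (T Cf : R) (f : R -> (V -> R^o)),
    dense_embedding iota ->
    energy_operator L ->
    0 < T ->
    (forall t, cont_dual V (f t)) ->
    (forall t, 0 <= t <= T -> dual_norm (f t) ^+ 2 <= Cf) ->
  exists C : R,
  forall (dt : R) (phi : nat -> V),
    0 < dt ->
    (forall n : nat, (k <= n.+1)%N -> n.+1%:R <= T / dt ->
       scheme_step iota L f k beta dt phi n) ->
  forall n : nat, (k <= n.+1)%N -> n.+1%:R <= T / dt ->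
    (forall t, T < t <= (n%:R + beta) * dt -> dual_norm (f t) ^+ 2 <= Cf) ->
    g * `|iota (phi n.+1)| ^+ 2
      + 2^-1 * dt * eta_coef k beta
        * \sum_(k <= q < n.+2) `|C_op k beta phi q| ^+ 2
    <= C * \sum_(0 <= q < k)
             (`|iota (phi q)| ^+ 2 + dt * `|phi q| ^+ 2)
       + T * Cf / (2 * eta_coef k beta).
Proof.
move=> kbeta.
have [eta0 [g [G [g0 GP]]] [g' [G' [g'0 GP']]]] := dissipative_scheme k beta kbeta.
have k0 : (0 < k)%N by case: kbeta => [[[->|->] _]|[-> _]].
have beta0 : 0 <= beta by case: kbeta => [[_ ?]|[_ ?]]; lra.
clear kbeta.
exists g => // V H iota L T Cf f _ Le T0 fc fCf.
have hH := psd_form_inner iota; have hV := psd_form_energy L Le.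
have [C CP] := energy0_le k _ _ G G' hH hV.
exists C => dt phi dt0 sch n kn nT late.
set eta := eta_coef k beta in eta0 *.
pose E := energy k (fun u v : V => inner (iota u) (iota v))
  (fun u v : V => L u v : R) G G' dt phi.
have GD x : quad (fun u v : V => L u v : R) k.-1 G' (x \o S)
    - quad (fun u v : V => L u v : R) k.-1 G' x
    <= (L (\sum_(i < k) (excess k beta)`_i *: x i)
          (\sum_(i < k) (c_coef k beta)`_i *: x i) : R).
  by have [_] := GP' _ _ x hV; rewrite prednK.
(* Telescoping: the step from [p] to [p.+1] produces iterate [p + k], which is [m.+1] below. *)
have sumE p : (p + k <= n.+2)%N ->
    E p + 2^-1 * dt * eta * \sum_(k <= q < p + k) `|C_op k beta phi q| ^+ 2
    <= E 0%N + p%:R * (dt * (Cf / (2 * eta))).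
  elim: p => [|p IH] pk; first by rewrite add0n big_geq // mulr0 mul0r.
  have [m mE] : exists m, (p + k)%N = m.+1.
    by exists (p + k).-1; rewrite prednK // addn_gt0 k0 orbT.
  have mn : (m <= n)%N by rewrite addSn mE in pk.
  have km : (k <= m.+1)%N by rewrite -mE leq_addl.
  have mT : m.+1%:R <= T / dt.
    by apply: le_trans nT; rewrite ler_nat.
  (* As [beta > 1], the source may be evaluated past [T]; [late] covers this case because
     [m <= n]. *)
  have fm : dual_norm (f ((m%:R + beta) * dt)) ^+ 2 <= Cf.
    have [tT|tT] := leP ((m%:R + beta) * dt) T.
      by apply: fCf; rewrite tT andbT mulr_ge0 ?addr_ge0 // ltW.
    by apply: late; rewrite tT ler_pM2r // lerD2r ler_nat.
  have step := energy_step iota L f k beta dt Cf G G' phi p m Le fc dt0 eta0 k0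
    (fun x => (GP _ _ x hH).2) GD mE (sch m km mT) fm.
  rewrite addSn big_nat_recr /=; last exact: leq_addl.
  rewrite mE mulrDr -[p.+1%:R]natr1.
  have {IH} := IH (ltnW pk); move: step; rewrite mE -/eta /E => *; lra.
have [p pE] : exists p, (p + k)%N = n.+2 by exists (n.+2 - k)%N; rewrite subnK // leqW.
have := sumE p; rewrite pE leqnn => /(_ isT) sumEp.
have sq_energy (u : V) : `|u| ^+ 2 = L u u.
  by have [_ _ _ ->] := Le; rewrite sqr_sqrtr // (psd_ge0 hV).
under [X in _ <= C * X + _]eq_bigr => q _ do rewrite -sqr_norm_inner sq_energy.
(* The newest iterate in the energy at [p] is [phi n.+1]; the [V] part is nonnegative and is
   dropped. *)
have Ep : g * `|iota (phi n.+1)| ^+ 2 <= E p.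
  have [gE _] := GP _ _ (fun q => phi (p + q)%N) hH.
  have [gE' _] := GP' _ _ (fun q => phi (p.+1 + q)%N) hV.
  rewrite -sqr_norm_inner.
  have -> : n.+1 = (p + k.-1)%N by apply: succn_inj; rewrite -pE -addnS prednK.
  apply: (le_trans gE); rewrite lerDl.
  apply: mulr_ge0; first exact: ltW.
  apply: le_trans gE'; apply: mulr_ge0; [exact: ltW | exact: (psd_ge0 hV)].
have Cf0 : 0 <= Cf.
  by apply: (le_trans (sqr_ge0 (dual_norm (f 0)))); apply: fCf; rewrite lexx ltW.
(* Since [k >= 1], at most [n + 1] steps have been summed. *)
have pT : p%:R * dt <= T.
  rewrite -ler_pdivlMr //; apply: le_trans nT.
  by rewrite ler_nat -ltnS -pE -[p.+1]addn1 leq_add2l.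
have : p%:R * (dt * (Cf / (2 * eta))) <= T * Cf / (2 * eta).
  by rewrite mulrA -[X in _ <= X]mulrA ler_wpM2r // divr_ge0 // mulr_ge0 // ltW.
have := CP dt phi dt0; move: sumEp Ep; rewrite /E -/eta; lra.
Qed.
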